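(* Let $n\in\mathbb{N}$. Then $$B_nB_n\subset B_n,\qquad A_nA_n\subset B_n,\qquad A_nB_n\subset A_n,\qquad B_nA_n\subset A_n.$$
   Context: $A_n$ is the space of matrices $M\in\mathbb{R}^{n\times n}$ with $M_{i,j}+M_{n+1-i,n+1-j}=0$ for all $i,j\in\{1,\dots,n\}$; $B_n$ is the space of matrices $M\in\mathbb{R}^{n\times n}$ with $M_{i,j}=M_{n+1-i,n+1-j}$ for all $i,j$. For sets of matrices $X,Y$, $XY$ denotes the set of matrix products $xy$ with $x\in X$, $y\in Y$. *)

(* Defs.v *)
From mathcomp Require Import all_boot all_order all_algebra.
From mathcomp Require Import classical_sets reals.

Set Implicit Arguments.
Unset Strict Implicit.
Unset Printing Implicit Defensive.

Import GRing.Theory.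

Local Open Scope ring_scope.
Local Open Scope classical_set_scope.

(* Indices are shifted to 0, ..., n-1, so the index n+1-i becomes n-1-i,
   which is [rev_ord i]. *)
Definition A_space (R : realType) (n : nat) : set 'M[R]_n :=
  [set M : 'M[R]_n | forall i j : 'I_n, M i j + M (rev_ord i) (rev_ord j) = 0].

Definition B_space (R : realType) (n : nat) : set 'M[R]_n :=
  [set M : 'M[R]_n | forall i j : 'I_n, M i j = M (rev_ord i) (rev_ord j)].

Definition mulmx_set (R : realType) (n : nat) (X Y : set 'M[R]_n) :
    set 'M[R]_n :=
  [set x *m y | x in X & y in Y].

Arguments A_space R n : clear implicits.
Arguments B_space R n : clear implicits.

(* Main.v *)
(* Reversing both index sets, M |-> mxsub rev_ord rev_ord M, is conjugation by
   the exchange matrix, hence multiplicative; B_n and A_n are its eigenspaces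
   for 1 and -1, so the four inclusions are the rule of signs. *)
Require Import Defs.
From mathcomp Require Import all_boot all_order all_algebra.
From mathcomp Require Import classical_sets reals.

Import GRing.Theory.

Local Open Scope ring_scope.
Local Open Scope classical_set_scope.

(** The inner index of the product is summed over all of ['I_n], and [rev_ord] permutes that range,
    so reversing it as well leaves each entry unchanged. *)
Lemma mxsub_rev_ord_mul (R : pzSemiRingType) (m n p : nat)
    (x : 'M[R]_(m, n)) (y : 'M[R]_(n, p)) :
  mxsub (@rev_ord m) (@rev_ord p) (x *m y) =
  mxsub (@rev_ord m) (@rev_ord n) x *m mxsub (@rev_ord n) (@rev_ord p) y.
Proof.
apply/matrixP=> i k; rewrite !mxE (reindex_inj rev_ord_inj) /=.
by apply: eq_bigr => j _; rewrite !mxE.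
Qed.

(** Trades the entrywise condition for a matrix equation, so that products can be treated without
    indices. *)
Lemma A_spaceP (R : realType) (n : nat) (M : 'M[R]_n) :
  A_space R n M <-> mxsub (@rev_ord n) (@rev_ord n) M = - M.
Proof.
split=> [AM | /matrixP AM i j].
  by apply/matrixP=> i j; rewrite !mxE; apply/eqP; rewrite -addr_eq0 addrC AM.
by have := AM i j; rewrite !mxE => ->; rewrite subrr.
Qed.

Lemma B_spaceP (R : realType) (n : nat) (M : 'M[R]_n) :
  B_space R n M <-> mxsub (@rev_ord n) (@rev_ord n) M = M.
Proof.
split=> [BM | /matrixP BM i j]; first by apply/matrixP=> i j; rewrite !mxE -BM.
by have := BM i j; rewrite !mxE.
Qed.

Theorem theorem3 (R : realType) (n : nat) :
  [/\ mulmx_set (B_space R n) (B_space R n) `<=` B_space R n,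
      mulmx_set (A_space R n) (A_space R n) `<=` B_space R n,
      mulmx_set (A_space R n) (B_space R n) `<=` A_space R n
    & mulmx_set (B_space R n) (A_space R n) `<=` A_space R n].
Proof.
split=> _ [x Xx [y Yy <-]].
- move/B_spaceP: Xx => Bx; move/B_spaceP: Yy => By.
  by apply/B_spaceP; rewrite mxsub_rev_ord_mul Bx By.
- move/A_spaceP: Xx => Ax; move/A_spaceP: Yy => Ay.
  (* Each factor contributes one sign, and [opprK] cancels the pair; in the two mixed cases below a
     single sign survives. *)
  by apply/B_spaceP; rewrite mxsub_rev_ord_mul Ax Ay mulNmx mulmxN opprK.
- move/A_spaceP: Xx => Ax; move/B_spaceP: Yy => By.
  by apply/A_spaceP; rewrite mxsub_rev_ord_mul Ax By mulNmx.
- move/B_spaceP: Xx => Bx; move/A_spaceP: Yy => Ay.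
  by apply/A_spaceP; rewrite mxsub_rev_ord_mul Bx Ay mulmxN.
Qed.
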